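(* Let $X\subseteq\mathbb R^d$, let $H$ be the reproducing kernel Hilbert space $H_\Omega$ for some $\Omega\subseteq X$ (the case $\Omega=X$ giving $H=H_X$), let $A\in\mathbb R^{d\times d}$, let $B\in\mathbb R^{d\times1}$, let $\Gamma:H\to H$ be a bounded, self-adjoint, positive definite linear operator with bounded inverse, and let $f\in H$. Let $x:[0,\infty)\to X$ be a classical solution of $\dot x(t)=Ax(t)+Bf(x(t))$, $x(0)=x_0$. Suppose that $P=I$, that $A$ is negative definite, that the family $$\mathcal F=\{h(x(\cdot)) : h\in H,\ \|h\|_H=1\}$$ of functions on $[0,\infty)$ is uniformly equi-continuous, and that $\Omega$ and $H=H_\Omega$ are persistently excited by the trajectory $\Gamma^+(x_0)=\bigcup_{t\ge0}\{x(t)\}$. Then every classical solution $(\tilde x,\tilde f):[0,\infty)\to\mathbb R^d\times H$ of the error equations $$\dot{\tilde x}(t)=A\tilde x(t)+B\mathcal E_{x(t)}\tilde f(t),\qquad \dot{\tilde f}(t)=-\Gamma^{-1}(B\mathcal E_{x(t)})^*P\tilde x(t)$$ satisfies $\lim_{t\to\infty}\tilde x(t)=0$ in $\mathbb R^d$ and $\lim_{t\to\infty}\tilde f(t)=0$ in $H$.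
   Context: RKH spaces: $H_X$ is the real reproducing kernel Hilbert space of functions $X\to\mathbb R$ induced by a continuous, symmetric, positive type (positive semidefinite) kernel $\mathfrak K_X$ on $X$ with $\sup_{x\in X}\mathfrak K_X(x,x)<\infty$; it is the closed span of the functions $\mathfrak K_{X,x}=\mathfrak K_X(x,\cdot)$, with $(\mathfrak K_{X,x},f)_{H_X}=f(x)$. For $\Omega\subseteq X$, $H_\Omega=\overline{\mathrm{span}\{\mathfrak K_{X,x}:x\in\Omega\}}\subseteq H_X$ with the inner product inherited from $H_X$. $\mathcal E_x:H\to\mathbb R$, $\mathcal E_xf=f(x)$, is the (bounded) evaluation functional. $(B\mathcal E_x)^*:\mathbb R^d\to H$ is the Hilbert space adjoint of $B\mathcal E_x:H\to\mathbb R^d$. $P$ denotes the symmetric positive definite matrix solving the Lyapunov equation $PA+A^TP=-Q$ for a symmetric positive definite $Q\in\mathbb R^{d\times d}$; here $P=I$. The error equations arise from $\tilde x=x-\hat x$, $\tilde f=f-\hat f$ with the estimator $\dot{\hat x}=A\hat x+B\mathcal E_{x(t)}\hat f$, $\dot{\hat f}=\Gamma^{-1}(B\mathcal E_{x(t)})^*P(x-\hat x)$. ''$A$ negative definite'' means $v^TAv<0$ for all $v\ne0$. A family $\mathcal F$ of functions on a set $S$ is uniformly equi-continuous if for each $\epsilon>0$ there is $\delta_\epsilon>0$ such that for all $h\in\mathcal F$ and $a,b\in S$, $|a-b|<\delta_\epsilon$ implies $\|h(a)-h(b)\|<\epsilon$. Persistence of excitation: $\Omega$ and $H=H_\Omega$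 are persistently excited by $\Gamma^+(x_0)$ if there are positive constants $\gamma_1,\gamma_2,T,\Delta$ such that for each $t\ge T$ and all $h\in H$, $$\gamma_1\|h\|_H^2\le\int_t^{t+\Delta}|h(x(\tau))|^2\,d\tau\le\gamma_2\|h\|_H^2,$$ where $|h(x(\tau))|^2=(\mathcal E_{x(\tau)}^*\mathcal E_{x(\tau)}h,h)_{H_X}$.
   Formalization: The formal theorem assumes B ≠ 0; for B = 0 the claim fails whenever H ≠ {0}, since x̃ = 0 with f̃ a nonzero constant solves the error equations (e.g. d = 1, X = Ω = {0}, kernel 1, A = −1, Γ = id, f = 0, x = 0). *)

(* Defs.v *)
From HB Require Import structures.
From mathcomp Require Export all_boot all_order all_algebra.
From mathcomp Require Export sesquilinear.
From mathcomp Require Export all_classical all_reals all_analysis.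

Set Implicit Arguments.
Unset Strict Implicit.
Unset Printing Implicit Defensive.

Import Order.TTheory GRing.Theory Num.Theory.
Import numFieldNormedType.Exports.

Local Open Scope classical_set_scope.
Local Open Scope ring_scope.

Definition linear_span (R : realType) (V : lmodType R) (S : set V) : set V :=
  [set v | exists (n : nat) (c : 'I_n -> R) (a : 'I_n -> V),
    (forall i, S (a i)) /\ v = \sum_(i < n) c i *: a i].

Section EuclideanSpace.
Variables (R : realType) (d : nat).
Implicit Types (u v : 'cV[R]_d) (M : 'M[R]_d).

Definition cdot u v : R := (u^T *m v) 0 0.

(* No symmetry is required of M. *)
Definition negative_definite M := forall v, v != 0 -> cdot v (M *m v) < 0.

Definition sym_positive_definite M :=
  M^T = M /\ forall v, v != 0 -> 0 < cdot v (M *m v).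

End EuclideanSpace.

Section Kernels.
Variables (R : realType) (d : nat) (X : set 'cV[R]_d).
Implicit Types (K : 'cV[R]_d -> 'cV[R]_d -> R).

(* Kernels are total functions, but only their values on X * X matter. *)
Definition admissible_kernel K :=
  [/\ {within X `*` X, continuous (fun p => K p.1 p.2)},
      forall x y, X x -> X y -> K x y = K y x,
      forall (n : nat) (p : 'I_n -> 'cV[R]_d) (c : 'I_n -> R),
        (forall i, X (p i)) ->
        0 <= \sum_(i < n) \sum_(j < n) c i * c j * K (p i) (p j)
    & exists M : R, forall x, X x -> K x x <= M].

(* The reproducing kernel Hilbert space of K, unique up to isometry.  Its
   vectors are identified with functions on X through the injective linear map
   [eval]; the values of [eval] and [feature] outside X are irrelevant. *)
Record rkhs K := Rkhs {
  vectors :> completeNormedModType R;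
  dot : {dot vectors for @idfun R};
  eval : vectors -> 'cV[R]_d -> R;
  feature : 'cV[R]_d -> vectors;
  dot_norm : forall h : vectors, dot h h = `|h| ^+ 2;
  eval_linear : forall (a : R) (g h : vectors) (x : 'cV[R]_d), X x ->
    eval (a *: g + h) x = a * eval g x + eval h x;
  eval_inj : forall g h : vectors,
    (forall x, X x -> eval g x = eval h x) -> g = h;
  eval_feature : forall x y, X x -> X y -> eval (feature x) y = K x y;
  reproducing : forall (h : vectors) x, X x -> dot (feature x) h = eval h x;
  feature_dense : closure (linear_span (feature @` X)) = setT
}.

End Kernels.

Section Operators.
Variables (R : realType) (d : nat) (X : set 'cV[R]_d).
Variables (K : 'cV[R]_d -> 'cV[R]_d -> R) (HX : rkhs X K).

(* H_Omega as a closed subspace of H_X; vectors of H_Omega are still functions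
   on all of X, and they carry the inner product of H_X. *)
Definition rkhs_sub (Omega : set 'cV[R]_d) : set HX :=
  closure (linear_span (feature HX @` Omega)).

(* Below, H is a closed subspace of HX, and an operator H -> H is represented
   by any function HX -> HX restricting to it: no condition bears on its values
   outside H. *)
Variable H : set HX.

Definition bounded_linear_on (S : HX -> HX) :=
  [/\ forall h, H h -> H (S h),
      forall (a : R) g h, H g -> H h -> S (a *: g + h) = a *: S g + S h
    & exists M : R, forall h, H h -> `|S h| <= M * `|h|].

Definition self_adjoint_on (S : HX -> HX) :=
  forall g h, H g -> H h -> dot HX (S g) h = dot HX g (S h).

Definition positive_definite_on (S : HX -> HX) :=
  forall h, H h -> h != 0 -> 0 < dot HX (S h) h.

Definition inverse_on (S Sinv : HX -> HX) :=
  forall h, H h -> Sinv (S h) = h /\ S (Sinv h) = h.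

(* B E_x, where B : R -> R^d is a column. *)
Definition BE (B : 'cV[R]_d) (x : 'cV[R]_d) (h : HX) : 'cV[R]_d :=
  eval h x *: B.

Definition is_adjoint (L : HX -> 'cV[R]_d) (La : 'cV[R]_d -> HX) :=
  forall v, H (La v) /\ forall h, H h -> dot HX (La v) h = cdot v (L h).

(* The Hilbert space adjoint R^d -> H of L : H -> R^d.  The junk value is never
   used when H is a closed subspace and L is linear and bounded on H. *)
Definition adjoint (L : HX -> 'cV[R]_d) : 'cV[R]_d -> HX :=
  xget (fun=> 0) [set La | is_adjoint L La].

End Operators.

Arguments rkhs_sub {R d X K} HX Omega.

Section HalfLine.
Variable R : realType.

Definition halfline : set R := `[0, +oo[.

(* u is continuously differentiable on [0, +oo[ with derivative du.  Difference
   quotients only use points of the half-line, hence are one-sided at 0. *)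
Definition C1_derivative (V : normedModType R) (u du : R -> V) :=
  (forall t, 0 <= t ->
    (s - t)^-1 *: (u s - u t) @[s --> within halfline t^'] --> du t) /\
  {within halfline, continuous du}.

Definition uniformly_equicontinuous (S : set R) (F : set (R -> R)) :=
  forall e, 0 < e -> exists2 delta, 0 < delta &
    forall h, F h -> forall a b, S a -> S b ->
      `|a - b| < delta -> `|h a - h b| < e.

Definition persistently_excited (d : nat) (X : set 'cV[R]_d)
    (K : 'cV[R]_d -> 'cV[R]_d -> R) (HX : rkhs X K) (H : set HX)
    (x : R -> 'cV[R]_d) :=
  exists gamma1 gamma2 T Delta : R,
    [/\ 0 < gamma1, 0 < gamma2, 0 < T, 0 < Delta
      & forall t h, T <= t -> H h ->
        gamma1 * `|h| ^+ 2
          <= \int[lebesgue_measure]_(tau in `[t, t + Delta])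
               (`|eval h (x tau)| ^+ 2)
          <= gamma2 * `|h| ^+ 2].

End HalfLine.

(* Main.v *)
Require Import Defs.
From mathcomp Require Import ring lra.

(** Write e_t for evaluation at x(t), k_t in H for its representer, and
    a_t = (B . xt) k_t for the value of the adjoint of B e_t at xt.  Since
    A + A^T = - Q, the energy V = |xt|^2 + <Gamma ft, ft> satisfies
    V' = - xt . Q xt: the coupling terms 2 (B . xt) e_t(ft) cancel, which is
    what the update law of ft is designed for.  Both Q and Gamma are coercive
    (a Cauchy-Schwarz argument from the bounded inverse,
    [coercive_of_inverse]), so V bounds xt and ft, and |xt|^2 has a derivative
    bounded above.  A dissipation argument of Barbalat type
    ([dissipation_cvg0]) then gives xt -> 0: if |xt(t)|^2 were at least e at
    arbitrarily late times, it would be at least e/2 on intervals of a fixed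
    length before these times, and V would lose a fixed amount infinitely
    often.

    For the parameter error, put y = B . xt.  Then y -> 0, and
    y' = B . A xt + |B|^2 e_t(ft), where B . A xt -> 0; moreover ft' -> 0,
    because |a_t| is at most a constant times |y|.  Persistence of excitation
    gives, in every window [t, t + D] with t large, a time tau at which
    |e_tau(h)| >= c |h| with h = ft(t), and uniform equicontinuity extends this
    to e_s(h) having constant sign and modulus at least (c/2) |h| for s in
    [tau, tau + delta], with delta independent of t and h
    ([excitation_on_intervals]).  On that interval ft is almost h, so y' is
    almost |B|^2 e_s(h), and y varies by about |B|^2 delta (c/2) |h| at least.
    As the variation of y is small, |ft(t)| is small
    ([excited_parameter_cvg0]).

    All of this uses derivatives only through the mean value inequality; the
    integral appears only in passing from persistence of excitation to the
    existence of tau.  The adjoint is the intended one, rather than a default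
    value, by the projection theorem in H ([orthogonal_projection]). *)

Set Implicit Arguments.
Unset Strict Implicit.
Unset Printing Implicit Defensive.

Import Order.TTheory GRing.Theory Num.Theory.
Import numFieldNormedType.Exports.

Local Open Scope classical_set_scope.
Local Open Scope ring_scope.

(** * Semidefinite forms *)

Section Forms.
Variables (R : realType) (V : lmodType R).
Implicit Types (S : set V) (b : V -> V -> R).

Definition linear_combination_closed S :=
  forall (a : R) u v, S u -> S v -> S (a *: u + v).

Lemma combination_add S u v :
  linear_combination_closed S -> S u -> S v -> S (u + v).
Proof. by move=> cS Su Sv; rewrite -[u]scale1r; exact: cS. Qed.

Lemma combination_scale S a u :
  linear_combination_closed S -> S u -> S (a *: u).
Proof.
move=> cS Su; rewrite -[_ *: u]addr0; apply: (cS) => //.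
by rewrite -(addNr u) -scaleN1r; exact: cS.
Qed.

(** Relative to a subset [S], because the operators at hand are only linear and
    self-adjoint on a subspace. *)
Record semidefinite_form S b : Prop := SemidefiniteForm {
  sform_linear : forall (a : R) u v w, S u -> S v -> S w ->
    b (a *: u + v) w = a * b u w + b v w;
  sform_sym : forall u v, S u -> S v -> b u v = b v u;
  sform_ge0 : forall u, S u -> 0 <= b u u
}.

(** The quadratic t |-> b (t u + v) (t u + v) is nonnegative, so its
    discriminant is not positive. *)
Lemma form_cauchy_schwarz S b u v : linear_combination_closed S ->
  semidefinite_form S b -> S u -> S v -> b u v ^+ 2 <= b u u * b v v.
Proof.
move=> cS [blin bsym b0] Su Sv.
have quad t : 0 <= t ^+ 2 * b u u + 2 * t * b u v + b v v.
  have Sw : S (t *: u + v) by exact: cS.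
  have := b0 _ Sw.
  rewrite blin// (bsym u)// (bsym v (t *: u + v))// !blin// (bsym v u)//.
  by congr (_ <= _); ring.
have bu0 := b0 _ Su; have bv0 := b0 _ Sv.
have [bu|bu] := eqVneq (b u u) 0.
- have [->|buv] := eqVneq (b u v) 0; first by rewrite expr0n/= mulr_ge0.
  have := quad (- (b v v + 1) / (2 * b u v)).
  have -> : 2 * (- (b v v + 1) / (2 * b u v)) * b u v = - (b v v + 1) by field.
  by rewrite bu; lra.
- have bu_gt0 : 0 < b u u by rewrite lt_def bu.
  have := quad (- b u v / b u u).
  have -> : (- b u v / b u u) ^+ 2 * b u u + 2 * (- b u v / b u u) * b u v + b v v
     = (b u u * b v v - b u v ^+ 2) / b u u by field.
  by rewrite pmulr_lge0 ?invr_gt0// subr_ge0.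
Qed.

(** Cauchy-Schwarz for the form (u, v) |-> b (T u) v, applied to [Tinv u] and
    [u], reads (b u u)^2 <= b u (Tinv u) * b (T u) u; dividing by [b u u] gives
    the bound. *)
Lemma coercive_of_inverse S b (T Tinv : V -> V) (M : R) :
  linear_combination_closed S -> semidefinite_form S b ->
  semidefinite_form S (fun u v => b (T u) v) ->
  (forall u, S u -> [/\ S (Tinv u), T (Tinv u) = u & b (Tinv u) u <= M * b u u]) ->
  0 <= M -> forall u, S u -> b u u <= M * b (T u) u.
Proof.
move=> cS sb sT hT M0 u Su; have [Siu Tiu leM] := hT u Su.
have := form_cauchy_schwarz cS sT Siu Su; rewrite Tiu (sform_sym sb Su Siu) => CS.
have bu0 := sform_ge0 sb Su; have Tu0 : 0 <= b (T u) u := sform_ge0 sT Su.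
have [->|bu] := eqVneq (b u u) 0; first exact: mulr_ge0.
have bu_gt0 : 0 < b u u by rewrite lt_def bu.
rewrite -(ler_pM2l bu_gt0) -expr2; apply: le_trans CS _.
by rewrite mulrCA mulrA ler_wpM2r.
Qed.

End Forms.

(** * Derivatives and the mean value inequality *)

Section Derivatives.
Variable R : realType.

(** The derivative at an interior point, written with the moving point [s]
    rather than an increment: product rules then follow by factoring
    [phi s - phi t]. *)
Definition has_slope (V : normedModType R) (u : R -> V) (t : R) (l : V) :=
  (s - t)^-1 *: (u s - u t) @[s --> t^'] --> l.

Lemma C1_derivative_slope (V : normedModType R) (u du : R -> V) t :
  C1_derivative u du -> 0 < t -> has_slope u t (du t).
Proof.
move=> [+ _] t0 => /(_ t (ltW t0)); apply: cvg_trans; apply: cvg_app.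
have n0 : t^' (fun s : R => 0 < s) by apply: nbhs_dnbhs; exact: lt_nbhsr.
move=> P; apply: filterS2 n0 => s s0; apply.
by rewrite /halfline/= in_itv/= andbT ltW.
Qed.

Lemma has_slope_cvg (V : normedModType R) (u : R -> V) t l :
  has_slope u t l -> u s @[s --> t^'] --> u t.
Proof.
move=> ul.
have st0 : (s - t) @[s --> t^'] --> (0 : R).
  have cv : (s @[s --> t^'] --> t) by exact: nbhs_dnbhs.
  by rewrite -[X in _ --> X](subrr t); exact: cvgB cv (cvg_cst t).
have lim : (s - t) *: ((s - t)^-1 *: (u s - u t)) + u t @[s --> t^'] --> u t.
  rewrite -[X in _ --> X]add0r -[X in X + _](scale0r l).
  exact: cvgD (cvgZ st0 ul) (cvg_cst _).
apply: cvg_trans lim; apply: near_eq_cvg.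
near=> s; rewrite /= scalerA divff ?scale1r ?subrK// subr_eq0.
by near: s; exact: nbhs_dnbhs_neq.
Unshelve. all: by end_near. Qed.

Lemma has_slope_is_derive (u : R -> R) t l :
  has_slope u t l -> is_derive t 1 u l.
Proof.
move=> ul; suff cv : h^-1 *: ((u \o shift t) (h *: 1) - u t) @[h --> 0^'] --> l.
  by apply: DeriveDef; [apply/cvg_ex; exists l|apply/cvg_lim].
have : (h + t) @[h --> 0^'] --> t^'.
  move=> P; rewrite /dnbhs/within/= => /nbhs_ballP[e/= e0 Pe].
  apply/nbhs_ballP; exists e => //= h; rewrite /ball/= sub0r normrN => he h0.
  apply: Pe; last by rewrite -subr_eq0 addrK.
  by rewrite /ball/= opprD addrCA subrr addr0 normrN.
move=> /(cvg_comp _ _)/(_ ul); apply: cvg_trans; apply: near_eq_cvg.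
by near=> h; rewrite /= addrK [h *: 1]mulr1.
Unshelve. all: by end_near. Qed.

Lemma has_slopeD (u v : R -> R) t a b : has_slope u t a -> has_slope v t b ->
  has_slope (fun s => u s + v s) t (a + b).
Proof.
move=> ua vb; apply: cvg_trans (cvgD ua vb); apply: near_eq_cvg.
by near=> s; rewrite fctE /GRing.scale/=; ring.
Unshelve. all: by end_near. Qed.

Lemma has_slopeZ (u : R -> R) t c l : has_slope u t l ->
  has_slope (fun s => c * u s) t (c * l).
Proof.
move=> ul; apply: cvg_trans (cvgM (cvg_cst c) ul); apply: near_eq_cvg.
by near=> s; rewrite /GRing.scale/=; ring.
Unshelve. all: by end_near. Qed.

Definition jointly_continuous (V : normedModType R) (b : V -> V -> R) :=
  forall (F : set_system R) (u v : R -> V) (p q : V), Filter F ->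
  u @ F --> p -> v @ F --> q -> b (u s) (v s) @[s --> F] --> b p q.

(** A product rule in factored form.  With [w s = u s + u t] it differentiates
    the quadratic form of [b], and with [w] constant a linear functional. *)
Lemma has_slope_form (V : normedModType R) (b : V -> V -> R) (phi : R -> R)
    (u w : R -> V) t l w0 :
  (forall a g h, b (a *: g) h = a * b g h) -> jointly_continuous b ->
  has_slope u t l -> w s @[s --> t^'] --> w0 ->
  (\forall s \near t, phi s - phi t = b (u s - u t) (w s)) ->
  has_slope phi t (b l w0).
Proof.
move=> bZ bc ul ww0 phiE; apply: cvg_trans (bc _ _ _ _ _ _ ul ww0).
apply: near_eq_cvg; near=> s.
rewrite bZ; congr (_ * _); apply/esym; near: s.
exact: nbhs_dnbhs.
Unshelve. all: by end_near. Qed.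

Lemma increment_le (u du : R -> R) (a b L : R) : a <= b ->
  (forall t, a <= t <= b -> has_slope u t (du t)) ->
  (forall t, a <= t <= b -> du t <= L) -> u b - u a <= L * (b - a).
Proof.
move=> ab hu hdu.
have der t : a <= t <= b -> is_derive t 1 u (du t).
  by move=> /hu; exact: has_slope_is_derive.
have [| |c] := @MVT_segment R u du a b ab.
- by move=> t; rewrite in_itv/= => /andP[/ltW ? /ltW ?]; apply: der; apply/andP.
- apply: derivable_within_continuous => t; rewrite in_itv/= => tab.
  by have [] := der t tab.
rewrite in_itv/= => cab ->; rewrite ler_wpM2r ?subr_ge0//.
exact: hdu.
Qed.

Lemma nonincreasing_of_slope (V dV : R -> R) :
  (forall t : R, 0 < t -> has_slope V t (dV t)) ->
  (forall t : R, 0 < t -> dV t <= 0) ->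
  forall a b : R, 0 < a -> a <= b -> V b <= V a.
Proof.
move=> hV dV0 a b a0 ab; rewrite -subr_le0 -(mul0r (b - a)).
by apply: (increment_le ab (du := dV)) => t /andP[at_ _];
   [apply: hV|apply: dV0]; exact: lt_le_trans at_.
Qed.

(** If N t >= e, the upper bound L on N' forces N >= e/2 on the interval of
    length e / (2L) that ends at t, where V loses at least
    q (e/2) (e / (2L)).  This is impossible once V is closer than that to its
    infimum. *)
Lemma dissipation_cvg0 (V dV N dN : R -> R) (q L : R) : 0 < q -> 0 < L ->
  (forall t : R, 0 < t -> has_slope V t (dV t)) ->
  (forall t : R, 0 < t -> has_slope N t (dN t)) ->
  (forall t : R, 0 < t -> 0 <= V t) -> (forall t : R, 0 < t -> 0 <= N t) ->
  (forall t : R, 0 < t -> dV t <= - (q * N t)) ->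
  (forall t : R, 1 <= t -> dN t <= L) ->
  forall e : R, 0 < e -> exists2 T, 1 <= T & forall t : R, T <= t -> N t < e.
Proof.
move=> q0 L0 hV hN V0 N0 dVle dNle e e0.
have decr a b : 0 < a -> a <= b -> V b <= V a.
  apply: (nonincreasing_of_slope hV) => t t0; apply: le_trans (dVle t t0) _.
  by rewrite oppr_le0 mulr_ge0 ?N0// ltW.
pose E := [set V t | t in [set t | 1 <= t]].
have hiE : has_inf E.
  split; first by exists (V 1), 1 => /=.
  exists 0 => _ [t /= t1 <-]; apply: V0; exact: lt_le_trans t1.
pose eta := e / (2 * L).
have eta0 : 0 < eta by rewrite divr_gt0// mulr_gt0.
have gain0 : 0 < q * (e / 2) * eta by rewrite mulr_gt0// mulr_gt0// divr_gt0.
have [_ [T0 /= T01 <-] VT0] := inf_adherent gain0 hiE.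
exists (T0 + eta); first by rewrite ler_wpDr// ltW.
move=> t Tt; rewrite ltNge; apply/negP => Nt.
have ta : T0 <= t - eta by rewrite lerBrDr.
have ta1 : 1 <= t - eta := le_trans T01 ta.
have ta0 : 0 < t - eta by exact: lt_le_trans ta1.
have tat : t - eta <= t by rewrite gerBl ltW.
have Nge s : t - eta <= s <= t -> e / 2 <= N s.
  move=> /andP[as_ st].
  have : N t - N s <= L * (t - s).
    apply: (increment_le st (du := dN)) => r /andP[sr _].
      by apply: hN; apply: lt_le_trans sr; exact: lt_le_trans as_.
    by apply: dNle; apply: le_trans sr; exact: le_trans as_.
  have : L * (t - s) <= L * eta by rewrite ler_pM2l//; lra.
  have -> : L * eta = e / 2 by rewrite /eta; field; rewrite gt_eqF.
  lra.
have : V t - V (t - eta) <= - (q * (e / 2)) * (t - (t - eta)).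
  apply: (increment_le tat (du := dV)) => s st.
    by apply: hV; case/andP: st => as_ _; exact: lt_le_trans as_.
  have s0 : 0 < s by case/andP: st => as_ _; exact: lt_le_trans as_.
  by apply: le_trans (dVle _ s0) _; rewrite lerN2 ler_pM2l// Nge.
have := decr T0 (t - eta) (lt_le_trans ltr01 T01) ta.
have : inf E <= V t.
  by apply: ge_inf; [case: hiE|exists t => //=; exact: le_trans tat].
move: VT0; rewrite subKr mulNr; move: (inf E) => i; move: (q * (e / 2) * eta) => g; lra.
Qed.

End Derivatives.

(** * Hilbert space geometry *)

Lemma linear_span_closed (R : realType) (V : lmodType R) (S : set V) :
  linear_combination_closed (linear_span S).
Proof.
move=> a _ _ [m [c1 [w1 [Sw1 ->]]]] [n [c2 [w2 [Sw2 ->]]]].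
exists (m + n)%N,
  (fun i : 'I_(m + n) =>
     match fintype.split i with inl j => a * c1 j | inr k => c2 k end),
  (fun i : 'I_(m + n) =>
     match fintype.split i with inl j => w1 j | inr k => w2 k end).
split; first by move=> i; case: (fintype.split i).
rewrite big_split_ord/= scaler_sumr; congr (_ + _); apply: eq_bigr => i _.
  by rewrite (unsplitK (inl i)) scalerA.
by rewrite (unsplitK (inr i)).
Qed.

Lemma linear_span0 (R : realType) (V : lmodType R) (S : set V) : linear_span S 0.
Proof.
exists 0%N, (fun=> 0), (fun=> 0); split; first by case.
by rewrite big_ord0.
Qed.

Lemma closure_linear_combination (R : realType) (V : normedModType R) (S : set V) :
  linear_combination_closed S -> linear_combination_closed (closure S).
Proof.
move=> cS a u v Su Sv B /nbhs_ballP[e /= e0 Be].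
have r0 : 0 < e / 2 / (`|a| + 1) by rewrite !divr_gt0// ltr_wpDl.
have [u' [Su']] := Su _ (nbhsx_ballx u _ r0).
have e20 : 0 < e / 2 by rewrite divr_gt0.
have [v' [Sv']] := Sv _ (nbhsx_ballx v _ e20).
rewrite -!ball_normE/= => vv' uu'; exists (a *: u' + v'); split; first exact: cS.
apply: Be; rewrite -ball_normE/= opprD addrACA -scalerBr.
rewrite (le_lt_trans (ler_normD _ _))// [e]splitr ler_ltD// normrZ.
have /ltW := uu'; rewrite ler_pdivlMr ?ltr_wpDl//; apply: le_trans.
by rewrite mulrC ler_wpM2l// lerDl.
Qed.

Section InnerProduct.
Variables (R : realType) (V : completeNormedModType R).
Variable ip : {dot V for @idfun R}.
Variable ip_norm : forall h : V, ip h h = `|h| ^+ 2.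

Lemma ipDl u v w : ip (u + v) w = ip u w + ip v w. Proof. exact: linearDl. Qed.
Lemma ipZl a u w : ip (a *: u) w = a * ip u w. Proof. by rewrite linearZl_LR. Qed.
Lemma ipC u v : ip u v = ip v u. Proof. by rewrite hermC expr0 mul1r. Qed.
Lemma ipNl u w : ip (- u) w = - ip u w. Proof. exact: linearNl. Qed.
Lemma ipBl u v w : ip (u - v) w = ip u w - ip v w. Proof. exact: linearBl. Qed.
Lemma ipDr u v w : ip w (u + v) = ip w u + ip w v.
Proof. by rewrite ipC ipDl !(ipC w). Qed.
Lemma ipZr a u w : ip w (a *: u) = a * ip w u.
Proof. by rewrite ipC ipZl (ipC w). Qed.
Lemma ipNr u w : ip w (- u) = - ip w u.
Proof. by rewrite ipC ipNl (ipC w). Qed.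
Definition ipE := (ipDl, ipDr, ipNl, ipNr, ipZl, ipZr).

Lemma ip_semidefinite (S : set V) : semidefinite_form S ip.
Proof.
split=> [a u v w _ _ _|u v _ _|u _]; rewrite ?ipE//; first exact: ipC.
by rewrite ip_norm sqr_ge0.
Qed.

Lemma ip_le_norm u v : `|ip u v| <= `|u| * `|v|.
Proof.
rewrite -ler_sqr ?nnegrE ?mulr_ge0// real_normK ?num_real// exprMn -!ip_norm.
by apply: (form_cauchy_schwarz (S := setT)) => //; exact: ip_semidefinite.
Qed.

(** By polarization, continuity of the norm suffices. *)
Lemma ip_continuous : jointly_continuous (fun u v => ip u v).
Proof.
move=> F u v p q FF up vq.
have polar g h : ip g h = 4^-1 * (`|g + h| ^+ 2 - `|g - h| ^+ 2).
  by rewrite -!ip_norm !ipE (ipC h g); field.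
rewrite polar; under eq_fun do rewrite polar.
have sq (w : R -> V) r : w s @[s --> F] --> r ->
    `|w s| ^+ 2 @[s --> F] --> `|r| ^+ 2.
  by move=> wr; under eq_fun do rewrite expr2; rewrite expr2;
     apply: cvgM; exact: cvg_norm.
apply: cvgM; first exact: cvg_cst.
by apply: cvgB; apply: sq; [exact: cvgD|exact: cvgB].
Qed.

(** The sets of almost minimizers of |v - h| in S form a Cauchy filter base by
    the parallelogram identity; its limit k is a minimizer, and first-order
    optimality of k along each direction h is the orthogonality of v - k to
    h. *)
Lemma orthogonal_projection (S : set V) (v : V) :
  linear_combination_closed S -> S !=set0 -> closed S ->
  exists2 k, S k & forall h, S h -> ip k h = ip v h.
Proof.
move=> cS [h0 Sh0] clS.
pose D := [set `|v - h| ^+ 2 | h in S].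
have hiD : has_inf D.
  split; first by exists (`|v - h0| ^+ 2), h0.
  by exists 0 => _ [h _ <-]; exact: sqr_ge0.
have infle h : S h -> inf D <= `|v - h| ^+ 2.
  by move=> Sh; apply: ge_inf; [case: hiD|exists h].
pose B e := S `&` [set h | `|v - h| ^+ 2 < inf D + e].
pose F := filter_from [set e : R | 0 < e] B.
have FF : ProperFilter F.
  apply: filter_from_proper; last first.
    move=> e /= e0; have [_ [h Sh <-] ?] := inf_adherent e0 hiD.
    by exists h.
  apply: filter_from_filter; first by exists 1 => /=.
  move=> i j /= i0 j0; exists (Num.min i j); first by rewrite /= lt_min i0.
  move=> h [Sh /=]; rewrite -ltrBlDl lt_min => /andP[hi hj].
  by split; split => //=; rewrite -ltrBlDl.
have close g h e : B e g -> B e h -> `|g - h| ^+ 2 <= 4 * e.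
  move=> [Sg /= ge] [Sh /= he].
  (* The midpoint of two almost minimizers is no closer to v than the infimum. *)
  have Sm : S (2^-1 *: (g + h)).
    by apply: combination_scale => //; exact: combination_add.
  have := infle _ Sm; move: ge he.
  rewrite -!ip_norm !ipE (ipC g v) (ipC h v) (ipC h g).
  lra.
have cF : cauchy F.
  apply: cauchy_exP => e e0.
  have e40 : 0 < e ^+ 2 / 8 by rewrite divr_gt0// exprn_gt0.
  have [_ [g Sg <-] gD] := inf_adherent e40 hiD.
  exists g, (e ^+ 2 / 8) => // h Bh; rewrite -ball_normE/=.
  rewrite -ltr_sqr ?nnegrE ?(ltW e0)//.
  have /le_lt_trans := close g h (e ^+ 2 / 8) (conj Sg gD) Bh; apply.
  have : 0 < e ^+ 2 by rewrite exprn_gt0.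
  lra.
have /cvg_ex[k Fk] : cvg F by exact: cauchy_cvg cF.
have Sk : S k.
  apply: (closed_cvg (F := F) (u_ := id) S clS) => //.
  by exists 1 => //= h [].
have kD : `|v - k| ^+ 2 <= inf D.
  have lim : `|v - h| ^+ 2 @[h --> F] --> `|v - k| ^+ 2.
    have cv : `|v - h| @[h --> F] --> `|v - k|.
      by apply: cvg_norm; apply: cvgB => //; exact: cvg_cst.
    by under eq_fun do rewrite expr2; rewrite expr2; exact: cvgM.
  apply/ler_addgt0Pr => e e0; apply: (cvgr_to_le lim).
  by exists e => //= h [_ /= /ltW].
exists k => // h Sh; apply/eqP; rewrite eq_sym -subr_eq0 -ipBl.
have var t : 0 <= t ^+ 2 * `|h| ^+ 2 - 2 * t * ip (v - k) h.
  have := le_trans kD (infle _ (cS t h k Sh Sk)).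
  rewrite -!ip_norm !ipE (ipC k v) (ipC h v) (ipC h k).
  lra.
apply/eqP; have [h00|hn0] := eqVneq h 0; first by rewrite h00 ipC linear0l.
have hh : 0 < `|h| ^+ 2 by rewrite exprn_gt0// normr_gt0.
(* The value of t at which the quadratic [var] is least. *)
have := var (ip (v - k) h / `|h| ^+ 2).
have -> : (ip (v - k) h / `|h| ^+ 2) ^+ 2 * `|h| ^+ 2 -
   2 * (ip (v - k) h / `|h| ^+ 2) * ip (v - k) h = - (ip (v - k) h ^+ 2 / `|h| ^+ 2).
  by field; rewrite normr_eq0.
rewrite oppr_ge0 pmulr_lle0 ?invr_gt0// => le0.
by apply/eqP; rewrite -sqrf_eq0 eq_le le0 sqr_ge0.
Qed.

End InnerProduct.

(** * The Euclidean form on column vectors *)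

Section EuclideanForm.
Variables (R : realType) (d : nat).
Implicit Types (u v w : 'cV[R]_d) (M : 'M[R]_d).

Lemma cdotE u v : cdot u v = \sum_i u i 0 * v i 0.
Proof. by rewrite /cdot mxE; apply: eq_bigr => i _; rewrite mxE. Qed.

Lemma cdotC u v : cdot u v = cdot v u.
Proof. by rewrite !cdotE; apply: eq_bigr => i _; rewrite mulrC. Qed.

Lemma cdotDl u v w : cdot (u + v) w = cdot u w + cdot v w.
Proof. by rewrite /cdot linearD mulmxDl mxE. Qed.

Lemma cdotZl a u w : cdot (a *: u) w = a * cdot u w.
Proof. by rewrite /cdot linearZ/= -scalemxAl mxE. Qed.

Lemma cdotNl u w : cdot (- u) w = - cdot u w.
Proof. by rewrite -scaleN1r cdotZl mulN1r. Qed.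

Lemma cdotDr u v w : cdot w (u + v) = cdot w u + cdot w v.
Proof. by rewrite cdotC cdotDl !(cdotC w). Qed.

Lemma cdotZr a u w : cdot w (a *: u) = a * cdot w u.
Proof. by rewrite cdotC cdotZl (cdotC w). Qed.

Lemma cdot_mulmx M u v : cdot (M *m u) v = cdot u (M^T *m v).
Proof. by rewrite /cdot trmx_mul mulmxA. Qed.

Lemma sqr_coord_le_cdot u i : u i 0 ^+ 2 <= cdot u u.
Proof.
rewrite cdotE (bigD1 i)//= -expr2 lerDl sumr_ge0// => j _.
by rewrite -expr2 sqr_ge0.
Qed.

Lemma cdot_ge0 u : 0 <= cdot u u.
Proof. by rewrite cdotE sumr_ge0// => i _; rewrite -expr2 sqr_ge0. Qed.

Lemma cdot_gt0 u : u != 0 -> 0 < cdot u u.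
Proof.
move=> u0; rewrite lt_def cdot_ge0 andbT; apply: contra_neq u0 => uu0.
apply/matrixP => i j; rewrite ord1 mxE; apply/eqP.
by rewrite -sqrf_eq0 eq_le sqr_ge0 -{1}uu0 sqr_coord_le_cdot.
Qed.

Lemma cdot_semidefinite : semidefinite_form setT (@cdot R d).
Proof.
split=> [a u v w _ _ _|u v _ _|u _]; last exact: cdot_ge0.
  by rewrite cdotDl cdotZl.
exact: cdotC.
Qed.

Lemma cdot_cauchy_schwarz u v : cdot u v ^+ 2 <= cdot u u * cdot v v.
Proof. exact: form_cauchy_schwarz cdot_semidefinite _ _. Qed.

Lemma cdot_continuous : jointly_continuous (@cdot R d).
Proof.
move=> F u v p q FF up vq; rewrite cdotE; under eq_fun do rewrite cdotE.
apply: cvg_big => [|i _].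
  by move=> x; exact: add_continuous.
apply: cvgM.
  exact: cvg_comp up (@coord_continuous _ _ _ i 0 p).
exact: cvg_comp vq (@coord_continuous _ _ _ i 0 q).
Qed.

Lemma mulmx_form_bounded M :
  exists2 C, 0 <= C & forall u, cdot (M *m u) u <= C * cdot u u.
Proof.
exists (\sum_i \sum_j `|M i j|); first by do 2!apply: sumr_ge0 => ? _.
move=> u; rewrite cdotE mulr_suml; apply: ler_sum => i _.
rewrite mxE !mulr_suml; apply: ler_sum => j _; rewrite -mulrA.
apply: le_trans (ler_norm _) _; rewrite normrM ler_wpM2l//.
rewrite normrM; have := sqr_coord_le_cdot u i; have := sqr_coord_le_cdot u j.
rewrite -![u _ 0 ^+ 2]real_normK ?num_real//.
have := sqr_ge0 (`|u i 0| - `|u j 0|); nra.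
Qed.

Lemma positive_definite_coercive M : sym_positive_definite M ->
  exists2 C, 0 < C & forall u, cdot u u <= C * cdot (M *m u) u.
Proof.
move=> [symM posM].
have unitM : M \in unitmx.
  rewrite -row_free_unit -kermx_eq0; apply/eqP/row_matrixP => i; rewrite row0.
  apply/eqP; apply: contraT => ki0.
  have Mk0 : M *m (row i (kermx M))^T = 0.
    by apply: trmx_inj; rewrite trmx_mul trmxK symM -row_mul mulmx_ker row0 trmx0.
  have := posM (row i (kermx M))^T; rewrite Mk0 /cdot mulmx0 mxE ltxx; apply.
  by rewrite -(inj_eq trmx_inj) trmxK trmx0.
have [C C0 CM] := mulmx_form_bounded (invmx M).
exists (C + 1); first by rewrite ltr_wpDl.
have psdM : semidefinite_form setT (fun u v => cdot (M *m u) v).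
  split=> [a u v w _ _ _|u v _ _|u _].
  - by rewrite mulmxDr -scalemxAr cdotDl cdotZl.
  - by rewrite cdot_mulmx symM cdotC.
  - have [->|/posM] := eqVneq u 0; last by rewrite cdotC => /ltW.
    by rewrite mulmx0 cdot_ge0.
move=> u; apply: le_trans (_ : C * cdot (M *m u) u <= _); last first.
  by rewrite ler_wpM2r ?lerDl//; exact: (sform_ge0 psdM).
apply: (coercive_of_inverse (S := setT) (Tinv := mulmx (invmx M))
  _ cdot_semidefinite psdM) => // v _.
by split => //; rewrite mulKVmx.
Qed.

End EuclideanForm.

(** * Convergence to zero at infinity *)

Section AtInfinity.
Variable R : realType.

Lemma cvg0_pinftyP (V : normedModType R) (u : R -> V) :
  u t @[t --> +oo] --> 0 <->
  forall e : R, 0 < e -> exists T, forall t, T <= t -> `|u t| <= e.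
Proof.
rewrite cvgr0Pnorm_le; split=> [u0 e e0|u0 e e0].
  have [M [_ uM]] := u0 _ e0; exists (M + 1) => t Mt; apply: uM.
  by apply: lt_le_trans Mt; rewrite ltrDl.
have [T uT] := u0 e e0; near=> t; apply: uT; near: t.
by apply: nbhs_pinfty_ge; exact: num_real.
Unshelve. all: by end_near. Qed.

Lemma sqr_dominated_cvg0 (V : normedModType R) (u : R -> V) (N : R -> R) (C : R) :
  0 <= C -> (forall t, 0 < t -> `|u t| ^+ 2 <= C * N t) ->
  (forall e : R, 0 < e -> exists2 T, 1 <= T & forall t, T <= t -> N t < e) ->
  u t @[t --> +oo] --> 0.
Proof.
move=> C0 uN N0; apply/cvg0_pinftyP => e e0.
have C10 : 0 < C + 1 by rewrite ltr_wpDl.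
have [T T1 NT] := N0 (e ^+ 2 / (C + 1)) (divr_gt0 (exprn_gt0 _ e0) C10).
exists T => t Tt; have t0 : 0 < t := lt_le_trans (lt_le_trans ltr01 T1) Tt.
rewrite -ler_sqr ?nnegrE ?(ltW e0)//.
apply: le_trans (uN _ t0) _.
have [n0|n0] := leP 0 (N t); last first.
  by apply: le_trans (sqr_ge0 e); exact: mulr_ge0_le0 (ltW n0).
have := NT _ Tt; rewrite ltr_pdivlMr// => /ltW; apply: le_trans.
by rewrite mulrC ler_wpM2l// lerDl.
Qed.

End AtInfinity.

Section Excitation.
Variables (R : realType) (V : completeNormedModType R).
Variable ip : {dot V for @idfun R}.
Variable ip_norm : forall h : V, ip h h = `|h| ^+ 2.

(** The scalar mean value inequality, applied to the component of [u] along
    its own increment. *)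
Lemma norm_increment_le (u du : R -> V) (a b L : R) : a <= b ->
  (forall t, a <= t <= b -> has_slope u t (du t)) ->
  (forall t, a <= t <= b -> `|du t| <= L) -> `|u b - u a| <= L * (b - a).
Proof.
move=> ab hu hdu; set w := u b - u a.
have [->|w0] := eqVneq w 0.
  rewrite normr0 mulr_ge0 ?subr_ge0//.
  by apply: le_trans (hdu a _); rewrite ?normr_ge0// lexx.
have w_gt0 : 0 < `|w| by rewrite normr_gt0.
rewrite -(ler_pM2r w_gt0) -expr2 -ip_norm {1}/w (ipBl ip) -mulrAC.
apply: (increment_le (u := fun t => ip (u t) w) (du := fun t => ip (du t) w)) => //.
  move=> t tab; apply: (has_slope_form (b := fun g h => ip g h) (w := fun=> w) (u := u)).
  - by move=> *; rewrite ipZl.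
  - exact: ip_continuous.
  - exact: hu.
  - exact: cvg_cst.
  - by near=> s; rewrite ipBl.
move=> t tab; apply: le_trans (ler_norm _) _.
apply: le_trans (ip_le_norm ip_norm _ _) _.
by rewrite ler_wpM2r// hdu.
Unshelve. all: by end_near. Qed.

(** On [tau, tau + delta] the vector g stays within a small distance of g t,
    because its derivative tends to zero.  Hence sigma y' is at least
    beta c |g t| up to a small error, and the increment of y over that
    interval, itself small, bounds |g t|. *)
Lemma excited_parameter_cvg0 (e : R -> V -> R) (y r : R -> R) (g dg : R -> V)
    (beta kappa T D delta c : R) :
  0 < beta -> 0 <= kappa -> 0 <= D -> 0 < delta -> 0 < c ->
  (forall s u v, 0 < s -> e s (u + v) = e s u + e s v) ->
  (forall s u, 0 < s -> `|e s u| <= kappa * `|u|) ->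
  (forall t, 0 < t -> has_slope y t (r t + beta * e t (g t))) ->
  (forall t, 0 < t -> has_slope g t (dg t)) ->
  (forall t, T <= t -> exists tau sigma, [/\ t <= tau <= t + D, `|sigma| <= 1 &
     forall s, tau <= s <= tau + delta -> c * `|g t| <= sigma * e s (g t)]) ->
  y t @[t --> +oo] --> (0 : R) -> r t @[t --> +oo] --> (0 : R) ->
  dg t @[t --> +oo] --> (0 : V) -> g t @[t --> +oo] --> (0 : V).
Proof.
move=> beta0 kappa0 D0 delta0 c0 eD eB hy hg exc.
move=> /cvg0_pinftyP y0 /cvg0_pinftyP r0 /cvg0_pinftyP dg0.
apply/cvg0_pinftyP => eps eps0.
(* With y, r and dg at most eta beyond t, the two endpoint values of y cost
   2 eta, r costs delta eta, and the drift of g costs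
   delta beta kappa (D + delta) eta. *)
pose C := 2 + delta * (1 + beta * (kappa * (D + delta))).
have bcd0 : 0 < beta * c * delta by rewrite mulr_gt0// mulr_gt0.
have C0 : 0 < C.
  by rewrite ltr_pwDl// mulr_ge0 ?(ltW delta0)// addr_ge0// !mulr_ge0 ?addr_ge0// ltW.
pose eta := eps * (beta * c * delta) / C.
have eta0 : 0 < eta by rewrite divr_gt0// mulr_gt0.
have [Ty yT] := y0 _ eta0; have [Tr rT] := r0 _ eta0; have [Tg gT] := dg0 _ eta0.
exists (Num.max (Num.max 1 T) (Num.max Ty (Num.max Tr Tg))) => t.
rewrite !ge_max => /andP[/andP[t1 tT] /andP[ty /andP[tr tg]]].
have t0 : 0 < t by exact: lt_le_trans t1.
have [tau [sigma [/andP[ttau taut] sigma1 lo]]] := exc t tT.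
have drift s : t <= s <= tau + delta -> `|g s - g t| <= eta * (D + delta).
  move=> /andP[ts st]; apply: le_trans (_ : eta * (s - t) <= _); last first.
    by rewrite ler_pM2l//; lra.
  apply: (norm_increment_le (du := dg)) => // q /andP[tq _].
    by apply: hg; exact: lt_le_trans tq.
  by apply: gT; exact: le_trans tq.
have tau_delta : tau <= tau + delta by rewrite lerDl ltW.
have small a b : `|a| <= b -> - sigma * a <= b.
  move=> ab; apply: le_trans (ler_norm _) _; rewrite normrM normrN.
  by apply: le_trans ab; rewrite ler_piMl.
pose lowerB := eta * (1 + beta * (kappa * (D + delta))) - beta * c * `|g t|.
have step : - sigma * y (tau + delta) - - sigma * y tau <=
    lowerB * (tau + delta - tau).
  apply: (increment_le (u := fun s => - sigma * y s)
    (du := fun s => - sigma * (r s + beta * e s (g s))) tau_delta).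
    move=> s /andP[ts _]; apply/has_slopeZ/hy.
    exact: lt_le_trans t0 (le_trans ttau ts).
  move=> s tsd; have /andP[ts st] := tsd.
  have s0 : 0 < s by exact: lt_le_trans t0 (le_trans ttau ts).
  have := drift s; rewrite (le_trans ttau ts) st => /(_ isT) gst.
  have rs : `|r s| <= eta by apply: rT; exact: le_trans tr (le_trans ttau ts).
  have es : `|e s (g s - g t)| <= kappa * (eta * (D + delta)).
    by apply: le_trans (eB _ _ s0) _; rewrite ler_wpM2l.
  have -> : e s (g s) = e s (g s - g t) + e s (g t) by rewrite -eD// subrK.
  have h1 := small _ _ rs.
  have h2 : beta * (- sigma * e s (g s - g t)) <= beta * (kappa * (eta * (D + delta))).
    by rewrite ler_pM2l// small.
  have h3 : beta * (c * `|g t|) <= beta * (sigma * e s (g t)) by rewrite ler_pM2l// lo.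
  have := lerB (lerD h1 h2) h3.
  by congr (_ <= _); rewrite /lowerB; ring.
have y2 := small _ _ (yT tau (le_trans ty ttau)).
have y1' : - eta <= - sigma * y (tau + delta).
  rewrite mulNr lerN2 -[sigma]opprK mulNr -mulrN.
  by apply: small; rewrite normrN yT// (le_trans ty (le_trans ttau tau_delta)).
have etaC : eta * C = eps * (beta * c * delta) by rewrite /eta divfK// gt_eqF.
rewrite -(ler_pM2r bcd0) -etaC /C.
move: step; rewrite /lowerB; have -> : tau + delta - tau = delta by ring.
lra.
Unshelve. all: by end_near. Qed.
End Excitation.

(** * Evaluation and its adjoint *)

Section Evaluation.
Variables (R : realType) (d : nat) (X : set 'cV[R]_d).
Variables (K : 'cV[R]_d -> 'cV[R]_d -> R) (HX : rkhs X K).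

Lemma evalD (g h : HX) p : X p -> eval (g + h) p = eval g p + eval h p.
Proof. by move=> Xp; rewrite -!reproducing// ipDr. Qed.

Lemma evalZ a (h : HX) p : X p -> eval (a *: h) p = a * eval h p.
Proof. by move=> Xp; rewrite -!reproducing// ipZr. Qed.

Lemma eval0 p : X p -> eval (0 : HX) p = 0.
Proof. by move=> Xp; rewrite -reproducing// linear0r. Qed.

Lemma eval_bounded : admissible_kernel X K ->
  exists2 kappa : R, 0 <= kappa &
    forall p (h : HX), X p -> `|eval h p| <= kappa * `|h|.
Proof.
move=> [_ _ _ [M KM]]; exists (`|M| + 1); first by rewrite addr_ge0.
move=> p h Xp; rewrite -reproducing//.
apply: le_trans (ip_le_norm (@dot_norm _ _ _ _ HX) _ _) _.
rewrite ler_wpM2r// -ler_sqr ?nnegrE ?addr_ge0// -dot_norm reproducing//.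
rewrite eval_feature//; apply: le_trans (KM p Xp) _.
apply: le_trans (ler_norm _) _; have := normr_ge0 M; nra.
Qed.

Lemma rkhs_sub_combination (Omega : set 'cV[R]_d) :
  linear_combination_closed (rkhs_sub HX Omega).
Proof. exact/closure_linear_combination/linear_span_closed. Qed.

(** The representer of evaluation at p in the subspace is the projection of the
    feature vector, which need not lie in the subspace when p is not in
    [Omega]. *)
Lemma adjoint_BE (Omega : set 'cV[R]_d) (B p : 'cV[R]_d) : X p ->
  is_adjoint (rkhs_sub HX Omega) (@BE _ _ _ _ HX B p)
    (adjoint (rkhs_sub HX Omega) (BE B p)).
Proof.
move=> Xp; have cH := @rkhs_sub_combination Omega.
have [k Hk kE] : exists2 k, rkhs_sub HX Omega k &
    forall h, rkhs_sub HX Omega h -> dot HX k h = dot HX (feature HX p) h.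
  apply: orthogonal_projection => //; first exact: dot_norm.
    by exists 0; apply: subset_closure; exact: linear_span0.
  exact: closed_closure.
rewrite /adjoint; case: xgetP => [La _ //|noadj].
case: (noadj (fun v => cdot v B *: k)) => v; split.
  exact: (combination_scale _ cH Hk).
by move=> h Hh; rewrite ipZl kE// reproducing// cdotZr mulrC.
Qed.

(** Testing the defining identity of the adjoint on its own value a gives
    |a|^2 = (v . B) a(p). *)
Lemma adjoint_BE_le (Omega : set 'cV[R]_d) (B p v : 'cV[R]_d) (kappa : R) :
  X p -> 0 <= kappa -> (forall h : HX, `|eval h p| <= kappa * `|h|) ->
  `|adjoint (rkhs_sub HX Omega) (@BE _ _ _ _ HX B p) v| <= kappa * `|cdot v B|.
Proof.
move=> Xp kappa0 ev; set a := adjoint _ _ v.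
have [Ha aE] : rkhs_sub HX Omega a /\ _ := adjoint_BE Omega B Xp v.
have [->|a0] := eqVneq a 0; first by rewrite normr0 mulr_ge0.
have a_gt0 : 0 < `|a| by rewrite normr_gt0.
rewrite -(ler_pM2l a_gt0) -expr2 -(@dot_norm _ _ _ _ HX) aE// cdotZr.
apply: le_trans (ler_norm _) _; rewrite normrM mulrA ler_wpM2r//.
by rewrite mulrC ev.
Qed.

End Evaluation.

(** * Persistence of excitation *)

Lemma exists_gt_of_integral_gt (R : realType) (g : R -> R) (a D m : R) : 0 < D ->
  {within `[a, a + D], continuous g} ->
  m * D < \int[lebesgue_measure]_(tau in `[a, a + D]) (g tau) ->
  exists2 tau, a <= tau <= a + D & m < g tau.
Proof.
move=> D0 cg mI; apply: contrapT => no.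
have le_m tau : `[a, a + D]%classic tau -> g tau <= m.
  rewrite /= in_itv/= => atD; rewrite leNgt; apply/negP => mg.
  by apply: no; exists tau.
have cst_c : {within `[a, a + D], continuous (fun=> m : R)}.
  by move=> ?; exact: cst_continuous.
have := @le_Rintegral _ _ _ (@lebesgue_measure R) `[a, a + D] g (fun=> m)
  (measurable_itv _).
move=> /(_ (continuous_compact_integrable (@segment_compact _ _ _) cg)).
move=> /(_ (continuous_compact_integrable (@segment_compact _ _ _) cst_c) le_m).
rewrite Rintegral_cst//= lebesgue_measure_itv/= lte_fin ltrDl D0 -EFinD/= addrAC subrr add0r.
by rewrite leNgt mI.
Qed.

Section PersistentExcitation.
Variables (R : realType) (d : nat) (X : set 'cV[R]_d).
Variables (K : 'cV[R]_d -> 'cV[R]_d -> R) (HX : rkhs X K).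

(** The unit-norm family controls all of H by homogeneity. *)
Lemma equicontinuous_eval (H : set HX) (x : R -> 'cV[R]_d) :
  linear_combination_closed H -> (forall t, 0 <= t -> X (x t)) ->
  uniformly_equicontinuous (@halfline R)
     [set g | exists h : HX, [/\ H h, `|h| = 1 & g = fun t => eval h (x t)]] ->
  forall e : R, 0 < e -> exists2 delta, 0 < delta & forall h, H h ->
    forall a b, 0 <= a -> 0 <= b -> `|a - b| < delta ->
    `|eval h (x a) - eval h (x b)| <= e * `|h|.
Proof.
move=> cH xX equi e e0; have [delta delta0 ed] := equi e e0.
exists delta => // h Hh a b a0 b0 ab.
have Xa := xX a a0; have Xb := xX b b0.
have [->|h0] := eqVneq h 0.
  by rewrite !eval0// subrr !normr0 mulr0.
have hgt0 : 0 < `|h| by rewrite normr_gt0.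
have := ed (fun t => eval (`|h|^-1 *: h) (x t)).
have /[swap]/[apply] : exists h0 : HX, [/\ H h0, `|h0| = 1 &
    (fun t => eval (`|h|^-1 *: h) (x t)) = fun t => eval h0 (x t)].
  exists (`|h|^-1 *: h); split => //; first exact: combination_scale.
  by rewrite normrZ normfV normr_id mulVf// gt_eqF.
move=> /(_ a b); rewrite /halfline/= !in_itv/= !andbT => /(_ a0 b0 ab).
rewrite !evalZ// -mulrBr normrM normfV normr_id mulrC ltr_pdivrMr//.
exact: ltW.
Qed.

(** In each window some value |h(x(tau))|^2 is at least half the average that
    persistence of excitation guarantees, so |h(x(tau))| >= c |h|.
    Equicontinuity with tolerance (c/2) |h| keeps the sign of h(x(s)) and half
    of this size for s in [tau, tau + delta], uniformly in t and h. *)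
Lemma excitation_on_intervals (H : set HX) (x : R -> 'cV[R]_d) :
  linear_combination_closed H -> (forall t, 0 <= t -> X (x t)) ->
  uniformly_equicontinuous (@halfline R)
     [set g | exists h : HX, [/\ H h, `|h| = 1 & g = fun t => eval h (x t)]] ->
  persistently_excited H x ->
  exists T D delta c, [/\ 0 < T, 0 < D, 0 < delta, 0 < c &
    forall t h, T <= t -> H h -> exists tau sigma,
      [/\ t <= tau <= t + D, `|sigma| <= 1 &
        forall s, tau <= s <= tau + delta -> c * `|h| <= sigma * eval h (x s)]].
Proof.
move=> cH xX equi [gamma1 [gamma2 [T [D [gamma10 _ T0 D0 pe]]]]].
have econt := equicontinuous_eval cH xX equi.
have level0 : 0 < gamma1 / (2 * D) by rewrite divr_gt0// mulr_gt0.
(* c ^ 2 is half of the average guaranteed by [pe]: the factor 1/2 makes the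
   comparison of integrals strict when h is nonzero. *)
pose c := Num.sqrt (gamma1 / (2 * D)).
have c0 : 0 < c by rewrite sqrtr_gt0.
have c20 : 0 < c / 2 by rewrite divr_gt0.
have [delta delta0 ed] := econt _ c20.
exists T, D, (delta / 2), (c / 2); split => //; first by rewrite divr_gt0.
move=> t h Tt Hh; have t0 : 0 < t := lt_le_trans T0 Tt.
have [->|h0] := eqVneq h 0.
  exists t, 0; split; rewrite ?normr0 ?lexx ?lerDl ?(ltW D0)// => s _.
  by rewrite mulr0 mul0r.
have hgt0 : 0 < `|h| by rewrite normr_gt0.
have cg : {within `[t, t + D], continuous (fun s => `|eval h (x s)| ^+ 2)}.
  apply/subspace_continuousP => s; rewrite /= in_itv/= => /andP[ts _].
  have cv : eval h (x r) @[r --> within `[t, t + D] (nbhs s)] --> eval h (x s).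
    apply/cvgrPdist_le => e e0.
    have [eta eta0 eE] := econt (e / `|h|) (divr_gt0 e0 hgt0).
    have near_s : \forall r \near s, `|s - r| < eta.
      by have := nbhsx_ballx s _ eta0; rewrite -ball_normE.
    apply: filterS near_s => r sr; rewrite /= in_itv/= => /andP[tr _].
    have := eE h Hh s r (le_trans (ltW t0) ts) (le_trans (ltW t0) tr) sr.
    by rewrite divfK ?gt_eqF.
  exact: cvgM (cvg_norm cv) (cvg_norm cv).
have [tau ttau mtau] : exists2 tau, t <= tau <= t + D &
    (c * `|h|) ^+ 2 < `|eval h (x tau)| ^+ 2.
  apply: (exists_gt_of_integral_gt D0 cg).
  have /andP[+ _] := pe t h Tt Hh; apply: lt_le_trans.
  rewrite exprMn sqr_sqrtr ?ltW//.
  have -> : gamma1 / (2 * D) * `|h| ^+ 2 * D = gamma1 * `|h| ^+ 2 / 2.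
    by field; rewrite gt_eqF.
  by rewrite ltr_pdivrMr// ltr_pMr ?ltr1n// mulr_gt0// exprn_gt0.
have {}mtau : c * `|h| <= `|eval h (x tau)|.
  by rewrite -ler_sqr ?nnegrE ?mulr_ge0 ?(ltW c0)// ltW.
exists tau, (Num.sg (eval h (x tau))); split => //.
  by rewrite normr_sg lern1 leq_b1.
move=> s /andP[taus sd].
have tau0 : 0 <= tau by case/andP: ttau => tt _; exact: le_trans (ltW t0) tt.
have := ed h Hh tau s tau0 (le_trans tau0 taus).
have -> : `|tau - s| < delta.
  rewrite distrC ger0_norm ?subr_ge0//.
  have : delta / 2 < delta by lra.
  lra.
move=> /(_ isT) close.
have -> : eval h (x s) = eval h (x tau) - (eval h (x tau) - eval h (x s)) by ring.
rewrite mulrBr -normrEsg.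
have : Num.sg (eval h (x tau)) * (eval h (x tau) - eval h (x s)) <= c / 2 * `|h|.
  apply: le_trans (ler_norm _) _; rewrite normrM.
  apply: le_trans close; rewrite ler_piMl// normr_sg lern1 leq_b1//.
lra.
Unshelve. all: by end_near. Qed.

End PersistentExcitation.

(** * The Lyapunov function *)

Section Energy.
Variables (R : realType) (d : nat) (X : set 'cV[R]_d).
Variables (K : 'cV[R]_d -> 'cV[R]_d -> R) (HX : rkhs X K).
Variable H : set HX.
Variable cH : linear_combination_closed H.

Lemma bounded_linear_on_nneg (S : HX -> HX) : bounded_linear_on H S ->
  exists2 M : R, 0 <= M & forall h, H h -> `|S h| <= M * `|h|.
Proof.
move=> [_ _ [M SM]]; exists `|M| => // h /SM /le_trans; apply.
by rewrite ler_wpM2r// ler_norm.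
Qed.

Lemma operator_semidefinite (G : HX -> HX) : bounded_linear_on H G ->
  self_adjoint_on H G -> positive_definite_on H G ->
  semidefinite_form H (fun u v => dot HX (G u) v).
Proof.
move=> [_ Glin _] Gsa Gpd; split=> [a u v w Hu Hv Hw|u v Hu Hv|u Hu].
- by rewrite Glin// !ipE.
- by rewrite Gsa// ipC.
- have [->|u0] := eqVneq u 0; first by rewrite linear0r.
  exact/ltW/Gpd.
Qed.

Lemma operator_coercive (G Ginv : HX -> HX) : bounded_linear_on H G ->
  self_adjoint_on H G -> positive_definite_on H G ->
  bounded_linear_on H Ginv -> inverse_on H G Ginv ->
  exists2 C : R, 0 <= C & forall h, H h -> `|h| ^+ 2 <= C * dot HX (G h) h.
Proof.
move=> bG Gsa Gpd bGinv GK.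
have [M M0 GinvM] := bounded_linear_on_nneg bGinv; have [HGinv _ _] := bGinv.
exists M => // h Hh; rewrite -(@dot_norm _ _ _ _ HX).
apply: (coercive_of_inverse cH (ip_semidefinite (@dot_norm _ _ _ _ HX) H)
  (operator_semidefinite bG Gsa Gpd) (Tinv := Ginv)) => // u Hu.
split; [exact: HGinv|by case: (GK u Hu)|].
apply: le_trans (ler_norm _) _.
apply: le_trans (ip_le_norm (@dot_norm _ _ _ _ HX) _ _) _.
by rewrite dot_norm expr2 mulrA ler_wpM2r// GinvM.
Qed.

(** Self-adjointness factors the increment of the energy from t to s as the
    inner product of g s - g t with G (g s) + G (g t). *)
Lemma has_slope_operator_energy (G : HX -> HX) (g : R -> HX) t l :
  bounded_linear_on H G -> self_adjoint_on H G ->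
  (forall s, 0 <= s -> H (g s)) -> 0 < t -> has_slope g t l ->
  has_slope (fun s => dot HX (G (g s)) (g s)) t (dot HX l (G (g t) + G (g t))).
Proof.
move=> bG Gsa gH t0 gl; have [HG Glin _] := bG.
have [M M0 GM] := bounded_linear_on_nneg bG.
have pos : \forall s \near t, 0 < s by exact: lt_nbhsr.
have GB u v : H u -> H v -> G (u - v) = G u - G v.
  move=> Hu Hv; have -> : u - v = (-1) *: v + u by rewrite scaleN1r addrC.
  by rewrite Glin// scaleN1r addrC.
have HB u v : H u -> H v -> H (u - v).
  by move=> Hu Hv; rewrite -scaleN1r addrC; exact: cH.
have Gcv : G (g s) @[s --> t^'] --> G (g t).
  apply/cvgrPdist_le => e e0.
  have M10 : 0 < M + 1 by rewrite ltr_wpDl.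
  near=> s; have s0 : 0 < s by near: s; exact: nbhs_dnbhs.
  have le_e : `|g t - g s| <= e / (M + 1).
    by near: s; exact: cvgr_dist_le (has_slope_cvg gl) _ (divr_gt0 e0 M10).
  move: le_e; rewrite ler_pdivlMr// => le_e.
  have Ht := gH t (ltW t0); have Hs := gH s (ltW s0).
  rewrite -GB//; apply: le_trans (GM _ (HB _ _ Ht Hs)) _.
  by apply: le_trans le_e; rewrite mulrC ler_wpM2l// lerDl.
apply: (has_slope_form (b := fun u v => dot HX u v) (u := g)
  (w := fun s => G (g s) + G (g t))) gl _ _.
- by move=> *; rewrite ipZl.
- exact: (ip_continuous (@dot_norm _ _ _ _ HX)).
- exact: cvgD Gcv (cvg_cst _).
- apply: filterS pos => s s0.
  have Ht := gH t (ltW t0); have Hs := gH s (ltW s0).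
  rewrite ipBl !ipDr (ipC (dot HX) (G (g s))) (ipC (dot HX) (G (g t))).
  by rewrite (ipC (dot HX) (g s) (G (g t))) (Gsa (g t) (g s))//; ring.
Unshelve. all: by end_near. Qed.

End Energy.

Lemma lyapunov_quadratic (R : realType) (d : nat) (A Q : 'M[R]_d) (v : 'cV[R]_d) :
  A + A^T = - Q -> cdot (A *m v) v + cdot (A *m v) v = - cdot (Q *m v) v.
Proof.
move=> AQ; have -> : Q = - (A + A^T) by rewrite AQ opprK.
rewrite mulNmx cdotNl opprK mulmxDl cdotDl.
by rewrite [in RHS](cdot_mulmx A^T) trmxK (cdotC v).
Qed.

Lemma has_slope_cdot (R : realType) (d : nat) (u : R -> 'cV[R]_d) (w l : 'cV[R]_d) t :
  has_slope u t l -> has_slope (fun s => cdot (u s) w) t (cdot l w).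
Proof.
move=> ul; apply: (has_slope_form (b := @cdot R d) (w := fun=> w) _ _ ul (cvg_cst _)).
- by move=> *; rewrite cdotZl.
- exact: cdot_continuous.
- by near=> s; rewrite cdotDl cdotNl.
Unshelve. all: by end_near. Qed.

Lemma has_slope_cdot_self (R : realType) (d : nat) (u : R -> 'cV[R]_d) (l : 'cV[R]_d) t :
  has_slope u t l ->
  has_slope (fun s => cdot (u s) (u s)) t (cdot l (u t + u t)).
Proof.
move=> ul; apply: (has_slope_form (b := @cdot R d) (w := fun s => u s + u t) _ _ ul).
- by move=> *; rewrite cdotZl.
- exact: cdot_continuous.
- exact: cvgD (has_slope_cvg ul) (cvg_cst _).
- near=> s; rewrite !(cdotDl, cdotDr, cdotNl) (cdotC (u t)); ring.
Unshelve. all: by end_near. Qed.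

Lemma sqr_norm_le_cdot (R : realType) (d : nat) (u : 'cV[R]_d) :
  `|u| ^+ 2 <= cdot u u.
Proof.
have [->|u0] := eqVneq u 0; first by rewrite normr0 expr0n cdot_ge0.
have [|[i j] uE] := @mx_norm_neq0 _ _ _ u.
  by apply: contra_neq u0; exact: mx_norm_eq0.
have -> : `|u| = `|u i j| by exact: uE.
by rewrite /= ord1 real_normK ?num_real// sqr_coord_le_cdot.
Qed.

Theorem theorem6 (R : realType) (d : nat) (X : set 'cV[R]_d)
  (K : 'cV[R]_d -> 'cV[R]_d -> R) (hK : admissible_kernel X K)
  (HX : rkhs X K) (Omega : set 'cV[R]_d) (hOmega : Omega `<=` X)
  (H : set HX) (hH : H = rkhs_sub HX Omega)
  (A : 'M[R]_d) (B : 'cV[R]_d) (hB : B != 0)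
  (Gamma Gammainv : HX -> HX)
  (hGamma : bounded_linear_on H Gamma)
  (hGamma_sa : self_adjoint_on H Gamma)
  (hGamma_pd : positive_definite_on H Gamma)
  (hGammainv : bounded_linear_on H Gammainv)
  (hGammaK : inverse_on H Gamma Gammainv)
  (f : HX) (hf : H f)
  (x0 : 'cV[R]_d) (x : R -> 'cV[R]_d)
  (hxX : forall t, 0 <= t -> X (x t))
  (hx : C1_derivative x (fun t => A *m x t + BE B (x t) f))
  (hx0 : x 0 = x0)
  (P Q : 'M[R]_d)
  (hPpd : sym_positive_definite P) (hQpd : sym_positive_definite Q)
  (hLyapunov : P *m A + A^T *m P = - Q)
  (hP : P = 1%:M)
  (hA : negative_definite A)
  (hequi : uniformly_equicontinuous (@halfline R)
     [set g | exists h : HX, [/\ H h, `|h| = 1 & g = fun t => eval h (x t)]])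
  (hPE : persistently_excited H x)
  (xt : R -> 'cV[R]_d) (ft : R -> HX)
  (hftH : forall t, 0 <= t -> H (ft t))
  (hxt : C1_derivative xt (fun t => A *m xt t + BE B (x t) (ft t)))
  (hft : C1_derivative ft
     (fun t => - Gammainv (adjoint H (BE B (x t)) (P *m xt t)))) :
  (xt t @[t --> +oo] --> (0 : 'cV[R]_d)) /\
  (ft t @[t --> +oo] --> (0 : HX)).
Proof.
have cH : linear_combination_closed H by rewrite hH; exact: rkhs_sub_combination.
have [kappa kappa0 evk] := eval_bounded HX hK.
have [CQ CQ0 coQ] := positive_definite_coercive hQpd.
have [CG CG0 coG] := operator_coercive cH hGamma hGamma_sa hGamma_pd hGammainv hGammaK.
have [CI CI0 CIle] := bounded_linear_on_nneg hGammainv.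
have AQ : A + A^T = - Q by rewrite -hLyapunov hP mul1mx mulmx1.
have Bpos := cdot_gt0 hB.
have dn := @dot_norm _ _ _ _ HX.
pose a t := adjoint H (BE B (x t)) (P *m xt t).
have Xx t : 0 < t -> X (x t) by move=> t0; exact/hxX/ltW.
have fH t : 0 < t -> H (ft t) by move=> t0; exact/hftH/ltW.
have aH t : 0 < t -> H (a t).
  by move=> t0; rewrite /a hH; case: (adjoint_BE HX Omega B (Xx t t0) (P *m xt t)).
have aE t h : 0 < t -> H h -> dot HX (a t) h = eval h (x t) * cdot (xt t) B.
  move=> t0 Hh; have [_] := adjoint_BE HX Omega B (Xx t t0) (P *m xt t).
  by rewrite -hH => -> //; rewrite hP mul1mx cdotZr.
have ale t : 0 < t -> `|a t| <= kappa * `|cdot (xt t) B|.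
  move=> t0; rewrite -[in cdot _ _](mul1mx (xt t)) -hP /a hH.
  by apply: adjoint_BE_le => // [|h]; [exact: Xx|exact/evk/Xx].
have sxt t : 0 < t -> has_slope xt t (A *m xt t + BE B (x t) (ft t)).
  exact: C1_derivative_slope hxt.
have sft t : 0 < t -> has_slope ft t (- Gammainv (a t)).
  exact: C1_derivative_slope hft.
pose e t := eval (ft t) (x t).
pose y t := cdot (xt t) B.
pose N t := cdot (xt t) (xt t).
pose V t := N t + dot HX (Gamma (ft t)) (ft t).
pose dN t := cdot (A *m xt t + BE B (x t) (ft t)) (xt t + xt t).
pose dV t := - cdot (Q *m xt t) (xt t).
(* The derivative of |xt|^2; the coupling term 2 e y is what the energy of ft
   compensates in [sV]. *)
have dNE t : dN t = dV t + 2 * (e t * y t).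
  rewrite /dN cdotDr !cdotDl /BE !cdotZl (cdotC B) /dV -(lyapunov_quadratic _ AQ).
  by rewrite /e /y; ring.
have sN t : 0 < t -> has_slope N t (dN t).
  by move=> t0; exact/has_slope_cdot_self/sxt.
have sV t : 0 < t -> has_slope V t (dV t).
  move=> t0; have := has_slopeD (sN t t0)
    (has_slope_operator_energy cH hGamma hGamma_sa hftH t0 (sft t t0)).
  have [HGi _ _] := hGammainv; have [_ GGinv] := hGammaK _ (aH t t0).
  have Eslope : dot HX (- Gammainv (a t)) (Gamma (ft t)) = - (e t * y t).
    rewrite ipNl -hGamma_sa; [|exact/HGi/aH|exact: fH].
    by rewrite GGinv aE//; exact: fH.
  by congr has_slope; rewrite ipDr Eslope dNE; ring.
have N0 t : 0 < t -> 0 <= N t by move=> _; exact: cdot_ge0.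
have E0 t : 0 < t -> 0 <= dot HX (Gamma (ft t)) (ft t).
  move=> t0; exact: (sform_ge0 (operator_semidefinite hGamma hGamma_sa hGamma_pd) (fH t t0)).
have V0 t : 0 < t -> 0 <= V t by move=> t0; rewrite addr_ge0 ?N0 ?E0.
have dVle t : 0 < t -> dV t <= - (CQ^-1 * N t).
  by move=> _; rewrite lerN2 mulrC ler_pdivrMr// mulrC coQ.
have dV_le0 t : 0 < t -> dV t <= 0.
  move=> t0; apply: le_trans (dVle t t0) _.
  by rewrite oppr_le0 mulr_ge0 ?N0// invr_ge0 ltW.
have V1 t : 1 <= t -> V t <= V 1.
  exact: (nonincreasing_of_slope sV dV_le0 ltr01).
have y2 t : y t ^+ 2 <= cdot B B * N t.
  by rewrite mulrC; exact: cdot_cauchy_schwarz.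
(* The final 1 makes the bound positive even when V 1 = 0. *)
have dNle t : 1 <= t -> dN t <= kappa ^+ 2 * (CG * V 1) + cdot B B * V 1 + 1.
  move=> t1; have t0 : 0 < t := lt_le_trans ltr01 t1.
  have e2 : e t ^+ 2 <= kappa ^+ 2 * (CG * V 1).
    rewrite -[e t ^+ 2]real_normK ?num_real//.
    apply: le_trans (_ : (kappa * `|ft t|) ^+ 2 <= _).
      by rewrite ler_sqr ?nnegrE ?mulr_ge0// evk//; exact: Xx.
    rewrite exprMn ler_wpM2l ?sqr_ge0//; apply: le_trans (coG _ (fH t t0)) _.
    by rewrite ler_wpM2l//; apply: le_trans (V1 t t1); rewrite lerDr N0.
  have yV : y t ^+ 2 <= cdot B B * V 1.
    apply: le_trans (y2 t) _; rewrite ler_wpM2l ?(ltW Bpos)//.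
    by apply: le_trans (V1 t t1); rewrite lerDl E0.
  have := dV_le0 t t0; have := sqr_ge0 (e t - y t); rewrite dNE; lra.
have N_cvg0 : forall eps : R, 0 < eps -> exists2 T, 1 <= T & forall t, T <= t -> N t < eps.
  apply: (dissipation_cvg0 _ _ sV sN V0 N0 dVle dNle); first by rewrite invr_gt0.
  have := V0 1 ltr01 => V10.
  by rewrite ltr_wpDl// addr_ge0// !mulr_ge0// ltW.
split.
  apply: (sqr_dominated_cvg0 (C := 1) _ _ N_cvg0) => // t _.
  by rewrite mul1r; exact: sqr_norm_le_cdot.
have [T [D [delta [c [T0 D0 delta0 c0 exc]]]]] := excitation_on_intervals cH hxX hequi hPE.
apply: (excited_parameter_cvg0 dn (e := fun t h => eval h (x t)) (y := y)
  (r := fun t => cdot (A *m xt t) B) (dg := fun t => - Gammainv (a t))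
  (beta := cdot B B) (kappa := kappa) (T := Num.max T 1) Bpos kappa0 (ltW D0) delta0 c0).
- by move=> s u v s0; rewrite evalD//; exact: Xx.
- by move=> s u s0; apply: evk; exact: Xx.
- move=> t t0; have := has_slope_cdot (w := B) (sxt t t0).
  by congr has_slope; rewrite cdotDl cdotZl mulrC.
- exact: sft.
- move=> t; rewrite ge_max => /andP[Tt t1]; apply: exc => //.
  by apply: fH; exact: lt_le_trans t1.
- apply: (sqr_dominated_cvg0 (C := cdot B B) _ _ N_cvg0) => [|t _]; first exact: ltW.
  by rewrite real_normK ?num_real.
- apply: (sqr_dominated_cvg0 (C := cdot (A^T *m B) (A^T *m B)) _ _ N_cvg0) => [|t _].
    exact: cdot_ge0.
  rewrite real_normK ?num_real// cdot_mulmx mulrC; exact: cdot_cauchy_schwarz.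
- apply: (sqr_dominated_cvg0 (C := (CI * kappa) ^+ 2 * cdot B B) _ _ N_cvg0) => [|t t0].
    by rewrite mulr_ge0 ?sqr_ge0// ltW.
  rewrite normrN -mulrA; apply: le_trans (_ : ((CI * kappa) * `|y t|) ^+ 2 <= _).
    rewrite ler_sqr ?nnegrE ?mulr_ge0//; apply: le_trans (CIle _ (aH t t0)) _.
    by rewrite -mulrA ler_wpM2l// ale.
  by rewrite exprMn ler_wpM2l ?sqr_ge0// real_normK ?num_real.
Qed.
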